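(* Let $V$ be a finite-dimensional diffeological vector space of dimension $n$, with underlying vector space identified with $\mathbb{R}^n$, and let $\langle\cdot|\cdot\rangle_A$, $\langle v|w\rangle_A=v^tAw$ with $A$ a real symmetric $n\times n$ matrix, be a pseudo-metric on $V$. Let $V_0\leq V$ be the subspace spanned by all the eigenvectors of $A$ belonging to positive eigenvalues, endowed with the subset diffeology, and let $V^*$ be the diffeological dual of $V$ endowed with the functional diffeology. Let $\Psi:V\to V^*$ be the map $v\mapsto[w\mapsto\langle w|v\rangle_A]$. Then the restriction $\Psi|_{V_0}:V_0\to V^*$ is a diffeomorphism.
   Context: A diffeology on a set $X$ is a collection of maps $U\to X$ (plots), $U$ ranging over open subsets of $\mathbb{R}^m$, $m\in\mathbb{N}$, such that: all constant maps are plots; if $p:U\to X$ is a plot and $h:U'\to U$ is an ordinary smooth map from an open set $U'$ of a Euclidean space, then $p\circ h$ is a plot; a map $U\to X$ that restricts to a plot on each member of an open cover of $U$ is a plot. A map between diffeological spaces is smooth if its composition with each plot of the source is a plot of the target; a diffeomorphism is a smooth bijection with smooth inverse. The product $X_1\times X_2$ has the product diffeology: a map $U\to X_1\times X_2$ is a plot iff both of its components are plots. The standard diffeology on $\mathbb{R}^k$ consists of all ordinary smooth maps into $\mathbb{R}^k$. A diffeological vector space is a real vector space $V$ with a diffeology for which addition $V\times V\to V$ and scalar multiplication $\mathbb{R}\times V\to V$ are smooth ($\mathbb{R}$ standard). The subset diffeology on a subspace $W\leq V$ consists of the maps $U\to W$ whose composition with the inclusion $W\hookrightarrow V$ is a plot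 of $V$. The diffeological dual $V^*$ is the vector space of all smooth linear functionals $V\to\mathbb{R}$ ($\mathbb{R}$ standard), endowed with the functional diffeology: a map $q:U\to V^*$ is a plot iff for every plot $p:U'\to V$ of $V$ the map $U\times U'\to\mathbb{R}$, $(u,u')\mapsto q(u)(p(u'))$, is smooth in the usual sense. A pseudo-metric on an $n$-dimensional diffeological vector space $V$ is a symmetric bilinear form $V\times V\to\mathbb{R}$, smooth for the product diffeology on $V\times V$ and the standard diffeology on $\mathbb{R}$, such that the eigenvalue $0$ (of its matrix) has multiplicity $n-\dim(V^* )$ and all the other eigenvalues are positive. *)

(* Defs.v *)
From HB Require Import structures.
From mathcomp Require Import all_boot all_order all_algebra.
From mathcomp Require Import boolp classical_sets functions reals topology normedtype derive.

Set Implicit Arguments.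
Unset Strict Implicit.
Unset Printing Implicit Defensive.

Import Order.TTheory GRing.Theory Num.Theory.
Import numFieldNormedType.Exports.

Local Open Scope classical_set_scope.
Local Open Scope ring_scope.

Section SmoothFunctions.
Variable R : realType.

(* Functions on a subset U of R^m are represented by total functions on
   'cV[R]_m, of which only the values on U matter. The definition below is
   meant for open U, so that partial derivatives at points of U depend only on
   the values on U. *)
Fixpoint Ck (k m : nat) (U : set 'cV[R]_m) (f : 'cV[R]_m -> R) : Prop :=
  (forall x, U x -> {for x, continuous f}) /\
  if k is k'.+1 then
    forall i : 'I_m, (forall x, U x -> derivable f x (delta_mx i 0)) /\
      Ck k' U (fun x => 'D_(delta_mx i 0) f x)
  else True.

Definition smooth_on (m : nat) (U : set 'cV[R]_m) (f : 'cV[R]_m -> R) : Prop :=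
  forall k, Ck k U f.

Definition smooth_mapping (m' m : nat) (U' : set 'cV[R]_m') (U : set 'cV[R]_m)
    (h : 'cV[R]_m' -> 'cV[R]_m) : Prop :=
  (forall x, U' x -> U (h x)) /\
  forall i : 'I_m, smooth_on U' (fun x => h x i 0).

Lemma Ck_ext k m (U : set 'cV[R]_m) (f g : 'cV[R]_m -> R) :
  open U -> (forall x, U x -> f x = g x) -> Ck k U f -> Ck k U g.
Proof.
move=> oU; elim: k f g => [|k IHk] f g fg [cf df].
all: have nfg x (Ux : U x) : \near x, f x = g x
       by apply: filterS (open_nbhs_nbhs (conj oU Ux)) => y /fg.
all: have cg x : U x -> {for x, continuous g}
       by move=> Ux; rewrite /prop_for /continuous_at -(fg _ Ux);
          apply: cvg_trans (cf _ Ux);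
          exact: (near_eq_cvg (F := nbhs x) (nfg x Ux)).
all: split=> // i.
have [dfi Cfi] := df i; split=> [x Ux|].
  by apply: near_eq_derivable (dfi x Ux); exact: nfg.
by apply: IHk Cfi => x Ux; apply: near_eq_derive; exact: nfg.
Qed.

Lemma Ck_cst k m (U : set 'cV[R]_m) (a : R) : open U -> Ck k U (fun=> a).
Proof.
move=> oU; elim: k a => [|k IHk] a.
all: have cc x : {for x, continuous (cst a : 'cV[R]_m -> R)}
    by exact: cst_continuous.
  by split=> // x _; exact: cc.
split=> [x _|i]; first exact: cc.
split=> [x _|]; first exact: (@derivable_cst R 'cV[R]_m R a).
by apply: Ck_ext (IHk 0) => // x _; rewrite derive_cst.
Qed.

Lemma CkD k m (U : set 'cV[R]_m) (f g : 'cV[R]_m -> R) :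
  open U -> Ck k U f -> Ck k U g -> Ck k U (fun x => f x + g x).
Proof.
move=> oU; elim: k f g => [|k IHk] f g [cf df] [cg dg].
all: have cc x : U x -> {for x, continuous (f \+ g)}
       by move=> Ux; exact: cvgD (cf x Ux) (cg x Ux).
all: split=> // i; have [[dfi Cfi] [dgi Cgi]] := (df i, dg i).
split=> [x Ux|]; first exact: derivableD (dfi x Ux) (dgi x Ux).
apply: Ck_ext (IHk _ _ Cfi Cgi) => // x Ux.
by rewrite -deriveD; [| exact: dfi | exact: dgi].
Qed.

Lemma CkZ k m (U : set 'cV[R]_m) (a : R) (f : 'cV[R]_m -> R) :
  open U -> Ck k U f -> Ck k U (fun x => a * f x).
Proof.
move=> oU; elim: k f => [|k IHk] f [cf df].
all: have cc x : U x -> {for x, continuous (fun x => a * f x)}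
       by move=> Ux; exact: cvgM (cvg_cst a) (cf x Ux).
all: split=> // i; have [dfi Cfi] := df i.
split=> [x Ux|]; first exact: (derivableZ (dfi x Ux)).
apply: Ck_ext (IHk _ Cfi) => // x Ux.
exact/esym/(deriveZ a (dfi x Ux)).
Qed.

End SmoothFunctions.

Section Diffeology.
Variable R : realType.

(* [D m U p] reads: the restriction of p to U is a plot U -> X. *)
Definition plot_family (X : Type) : Type :=
  forall m : nat, set 'cV[R]_m -> ('cV[R]_m -> X) -> Prop.

Record is_diffeology (X : Type) (D : plot_family X) : Prop := IsDiffeology {
  plot_open : forall m (U : set 'cV[R]_m) p, D m U p -> open U;
  (* being a plot depends only on the restriction to U *)
  plot_ext : forall m (U : set 'cV[R]_m) p q,
    (forall x, U x -> p x = q x) -> D m U p -> D m U q;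
  plot_cst : forall m (U : set 'cV[R]_m) (x : X), open U -> D m U (fun=> x);
  plot_comp : forall m (U : set 'cV[R]_m) p m' (U' : set 'cV[R]_m') h,
    D m U p -> open U' -> smooth_mapping U' U h -> D m' U' (p \o h);
  (* F is an open cover of the domain by plot_open *)
  plot_local : forall m (F : set (set 'cV[R]_m)) p,
    (forall O, F O -> D m O p) -> D m (\bigcup_(O in F) O) p
}.

Definition smooth (X Y : Type) (DX : plot_family X) (DY : plot_family Y)
    (f : X -> Y) : Prop :=
  forall m (U : set 'cV[R]_m) p, DX m U p -> DY m U (f \o p).

Definition diffeomorphism (X Y : Type) (DX : plot_family X)
    (DY : plot_family Y) (f : X -> Y) : Prop :=
  smooth DX DY f /\
  exists g : Y -> X, [/\ cancel f g, cancel g f & smooth DY DX g].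

Definition prod_plots (X Y : Type) (DX : plot_family X) (DY : plot_family Y) :
    plot_family (X * Y) :=
  fun m U p => DX m U (fst \o p) /\ DY m U (snd \o p).

Definition real_plots : plot_family R :=
  fun m U f => open U /\ smooth_on U f.

Record diffVect (V : lmodType R) := DiffVect {
  vplots :> plot_family V;
  vplots_diffeology : is_diffeology vplots;
  vadd_smooth : smooth (prod_plots vplots vplots) vplots
    (fun x : V * V => x.1 + x.2);
  vscale_smooth : smooth (prod_plots real_plots vplots) vplots
    (fun x : R * V => x.1 *: x.2)
}.

Definition sub_plots (V : vectType R) (D : plot_family V) (W : {vspace V}) :
    plot_family (subvs_of W) :=
  fun m U p => D m U (vsval \o p).

End Diffeology.

Arguments sub_plots {R V} D W.

Section Span.
Variables (R : realType) (V : vectType R).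

Lemma spanv_exists (S : set V) : exists U : {vspace V}, forall v,
  v \in U <-> exists2 s : seq V, (forall x, x \in s -> S x) & v \in <<s>>%VS.
Proof.
pose P d := `[< exists2 s : seq V, (forall x, x \in s -> S x) &
                  \dim <<s>>%VS = d >].
have exP : exists d, P d.
  by exists (\dim <<[::] : seq V>>%VS); apply/asboolP; exists [::].
have ubP d : P d -> (d <= \dim {:V})%N.
  by move=> /asboolP[s _ <-]; exact/dimvS/subvf.
case: (ex_maxnP exP ubP) => d /asboolP[s sS sd] maxd.
exists <<s>>%VS => v; split=> [vs|[t tS vt]]; first by exists s.
suff : (<<t>> <= <<s>>)%VS by move/subvP; apply.
have catS x : x \in t ++ s -> S x.
  by rewrite mem_cat => /orP[]; [exact: tS | exact: sS].
have le_s : (<<s>> <= <<t ++ s>>)%VS by rewrite span_cat addvSr.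
have /eqP-> : <<s>>%VS == <<t ++ s>>%VS.
  rewrite eqEdim le_s sd; apply: maxd.
  by apply/asboolP; exists (t ++ s).
by rewrite span_cat addvSl.
Qed.

Definition spanv (S : set V) : {vspace V} := projT1 (cid (spanv_exists S)).

Lemma spanvP (S : set V) (v : V) : v \in spanv S <->
  exists2 s : seq V, (forall x, x \in s -> S x) & v \in <<s>>%VS.
Proof. exact: (projT2 (cid (spanv_exists S))). Qed.

End Span.

Section Dual.
Variables (R : realType) (V : vectType R) (D : diffVect V).

Definition smooth_functional (f : 'Hom(V, R^o)) : Prop :=
  smooth D (@real_plots R) (f : V -> R).

Lemma smooth_functional0 : smooth_functional 0.
Proof.
move=> m U p Dp; have oU := plot_open (vplots_diffeology D) Dp.
split=> // k; apply: Ck_ext (Ck_cst k 0 oU) => // x _.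
by rewrite /= lfunE.
Qed.

Lemma smooth_functionalD f g :
  smooth_functional f -> smooth_functional g -> smooth_functional (f + g).
Proof.
move=> sf sg m U p Dp; have [oU Cf] := sf _ _ _ Dp; have [_ Cg] := sg _ _ _ Dp.
split=> // k; apply: Ck_ext (CkD oU (Cf k) (Cg k)) => // x _.
by rewrite /= lfunE.
Qed.

Lemma smooth_functionalZ a f :
  smooth_functional f -> smooth_functional (a *: f).
Proof.
move=> sf m U p Dp; have [oU Cf] := sf _ _ _ Dp.
split=> // k; apply: Ck_ext (CkZ a oU (Cf k)) => // x _.
by rewrite /= lfunE.
Qed.

Lemma dualv_exists : exists W : {vspace 'Hom(V, R^o)},
  forall f, f \in W <-> smooth_functional f.
Proof.
exists (spanv smooth_functional) => f; split; last first.
  move=> sf; apply/spanvP; exists [:: f]; last by rewrite span_seq1 memv_line.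
  by move=> x; rewrite inE => /eqP->.
move=> /spanvP[s sS fs]; rewrite (coord_span (X := in_tuple s) fs).
apply: (big_ind smooth_functional).
- exact: smooth_functional0.
- exact: smooth_functionalD.
move=> i _; apply: smooth_functionalZ; apply: sS; exact: mem_nth.
Qed.

(* The underlying vector space of the diffeological dual, as a subspace of the
   space of all linear functionals. *)
Definition dualv : {vspace 'Hom(V, R^o)} := projT1 (cid dualv_exists).

Lemma dualvP f : f \in dualv <-> smooth_functional f.
Proof. exact: (projT2 (cid dualv_exists)). Qed.

Definition functional_plots : plot_family R (subvs_of dualv) :=
  fun m U q => open U /\
    forall m' (U' : set 'cV[R]_m') (p : 'cV[R]_m' -> V), vplots D U' p ->
      smooth_on [set x : 'cV[R]_(m + m') | U (usubmx x) /\ U' (dsubmx x)]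
        (fun x => vsval (q (usubmx x)) (p (dsubmx x))).

End Dual.

Arguments functional_plots {R V} D.

Section PseudoMetric.
Variables (R : realType) (n : nat).
Implicit Types (V : diffVect 'cV[R]_n) (b : 'cV[R]_n -> 'cV[R]_n -> R).

Definition matrix_form (A : 'M[R]_n) (v w : 'cV[R]_n) : R :=
  (v^T *m A *m w) 0 0.

Definition gram_matrix b : 'M[R]_n :=
  \matrix_(i, j) b (delta_mx i 0) (delta_mx j 0).

(* The multiplicity of the eigenvalue 0 is its multiplicity as a root of the
   characteristic polynomial. The truncated subtraction is exact, dualv V being
   a subspace of the n-dimensional space of linear functionals on 'cV[R]_n.
   The library's eigenvalue refers to row vectors, which is immaterial for the
   symmetric gram_matrix b. *)
Record pseudo_metric V b : Prop := PseudoMetric {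
  pm_linearl : forall w, scalar (b ^~ w);
  pm_linearr : forall v, scalar (b v);
  pm_sym : forall v w, b v w = b w v;
  pm_smooth : smooth (prod_plots V V) (@real_plots R) (fun x => b x.1 x.2);
  pm_mult0 :
    mup 0 (char_poly (gram_matrix b)) = (n - \dim (dualv V))%N;
  pm_eigen_gt0 : forall a, eigenvalue (gram_matrix b) a -> a != 0 -> 0 < a
}.

Definition eigenvector (A : 'M[R]_n) (a : R) (v : 'cV[R]_n) : Prop :=
  v != 0 /\ A *m v = a *: v.

Definition pos_eigenspan (A : 'M[R]_n) : {vspace 'cV[R]_n} :=
  spanv [set v | exists2 a, 0 < a & eigenvector A a v].

Lemma pseudo_metric_linfunE V b (pmb : pseudo_metric V b) v w :
  linfun (fun w => b w v : R^o) w = b w v.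
Proof.
pose f : 'cV[R]_n -> R^o := fun w => b w v.
have lf : linear f by exact: (pm_linearl pmb v).
pose F : {linear 'cV[R]_n -> R^o} := HB.pack f (GRing.isLinear.Build R _ _ _ f lf).
exact: (lfunE F w).
Qed.

Lemma pseudo_metric_dual V b (pmb : pseudo_metric V b) v :
  linfun (fun w => b w v : R^o) \in dualv V.
Proof.
apply/dualvP => m U p Vp; have VD := vplots_diffeology V.
have Vpv : prod_plots V V U (fun x => (p x, v)).
  by split=> //; exact: plot_cst (plot_open VD Vp).
have [oU Cb] := pm_smooth pmb Vpv.
split=> // k; apply: Ck_ext (Cb k) => // x _.
by rewrite /= (pseudo_metric_linfunE pmb).
Qed.

Definition Psi V b (pmb : pseudo_metric V b) (v : 'cV[R]_n) :
    subvs_of (dualv V) :=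
  Subvs (pseudo_metric_dual pmb v).

Lemma PsiE V b (pmb : pseudo_metric V b) v w :
  vsval (Psi pmb v) w = b w v.
Proof. exact: (pseudo_metric_linfunE pmb). Qed.

End PseudoMetric.

(* Main.v *)
(* In a basis of eigenvectors of A, the multiplicity condition says that dim V^*
   is the rank of A, and the positivity condition that V_0 is the image of A.
   All the Psi v lie in V^*, so by dimension they fill it, and since A and A^2
   have the same row space, A = B A^2 for some B. Hence v = B (A v) on V_0: the
   inverse of Psi on V_0 sends a functional f to sum_j f(e_j) B e_j. Along a
   plot of V^* the numbers f(e_j) are smooth (test on constant plots), so the
   image under the inverse is a plot because the operations of V are smooth. *)
From HB Require Import structures.
Require Import Defs.
From mathcomp Require Import all_boot all_order all_algebra.
From mathcomp Require Import boolp classical_sets functions reals topology normedtype derive.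
From mathcomp Require complex.

Set Implicit Arguments.
Unset Strict Implicit.
Unset Printing Implicit Defensive.

Import Order.TTheory GRing.Theory Num.Theory.
Import numFieldNormedType.Exports.

Local Open Scope classical_set_scope.
Local Open Scope ring_scope.

(** * Ranks, characteristic polynomials and real symmetric matrices *)

Lemma rank_diag_mx (F : fieldType) n (d : 'rV[F]_n) :
  \rank (diag_mx d) = (\sum_i (d 0%R i != 0%R))%N.
Proof.
elim: n d => [|n IHn] d; first by rewrite flatmx0 mxrank0 big_ord0.
move: d; rewrite -[n.+1]/(1 + n)%N => d.
rewrite -[d]hsubmxK diag_mx_row rank_diag_block_mx IHn.
rewrite big_split_ord big_ord1 row_mxEl rank_rV; congr (_ + _)%N.
  congr (nat_of_bool (~~ _)); apply/eqP/eqP => [/matrixP/(_ 0 0)|d0].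
    by rewrite [LHS]mxE eqxx mulr1n [RHS]mxE.
  by apply/matrixP => i j; rewrite !ord1 mxE eqxx mulr1n d0 mxE.
by apply: eq_bigr => i _; rewrite row_mxEr.
Qed.

(** Over the polynomial ring [P] still intertwines the two characteristic matrices, and its
    determinant, a nonzero constant, can be cancelled. *)
Lemma char_poly_similar (F : fieldType) n (P A B : 'M[F]_n) :
  P \in unitmx -> P *m A = B *m P -> char_poly A = char_poly B.
Proof.
move=> Pu PA; rewrite /char_poly.
have PXu : \det (map_mx (@polyC F) P) != 0.
  by rewrite det_map_mx polyC_eq0 -unitfE -unitmxE.
apply: (mulfI PXu); rewrite [RHS]mulrC -!det_mulmx; congr (\det _).
by rewrite /char_poly_mx mulmxBr mulmxBl -!map_mxM PA scalar_mxC.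
Qed.

(** Similarity preserves both terms; for a diagonal matrix they count the zero and the nonzero
    diagonal entries. *)
Lemma mup0_char_poly_diagonalizable (F : fieldType) n (P A : 'M[F]_n) d :
  P \in unitmx -> P *m A = diag_mx d *m P ->
  (mup 0 (char_poly A) + \rank A)%N = n.
Proof.
move=> Pu PA; rewrite (char_poly_similar Pu PA).
have -> : \rank A = \rank (diag_mx d).
  by rewrite -(mxrankMfree (diag_mx d) (_ : row_free P)) ?row_free_unit // -PA
       (eqmxMfull A (_ : row_full P)) ?row_full_unit.
rewrite rank_diag_mx (char_poly_trig (diag_mx_is_trig d)).
rewrite -(big_map (fun i => diag_mx d i i) xpredT (fun y => 'X - y%:P)).
rewrite mu_prod_XsubC count_map -sum1_count big_mkcond -big_split /=.
rewrite -[RHS]card_ord -sum1_card [LHS]big_mkcond; apply: eq_big => i //= _.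
by rewrite mxE eqxx mulr1n; case: eqP.
Qed.

(** If x A A = 0, then x A has squared norm x A A x^T = 0, a sum of squares, so x A = 0. Hence A A
    and A have equal left kernels and equal ranks, and the row space of A A, contained in that of A,
    is all of it. *)
Lemma symmetric_sub_sqr (R : realFieldType) n (A : 'M[R]_n) :
  A^T = A -> (A <= A *m A)%MS.
Proof.
move=> symA.
have : (kermx (A *m A) <= kermx A)%MS.
  apply/sub_kermxP; set K := kermx _.
  have : (K *m A) *m (K *m A)^T = 0.
    by rewrite trmx_mul symA mulmxA -[K *m A *m A]mulmxA mulmx_ker mul0mx.
  move=> /matrixP KK; apply/matrixP => i j.
  move: (KK i i); rewrite !mxE => /eqP; rewrite psumr_eq0.
    move=> /allP/(_ j); rewrite mem_index_enum !mxE mulf_eq0 orbb.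
    by move=> /(_ isT)/eqP.
  by move=> k _; rewrite !mxE -expr2 sqr_ge0.
move=> /mxrankS; rewrite !mxrank_ker leq_sub2lE ?rank_leq_row // => rA.
by rewrite -(geq_leqif (mxrank_leqif_sup (submxMl A A))).
Qed.

Section Symmetric.
Import complex.

(** Over [R[i]] the matrix is Hermitian, so the spectral theorem makes it similar to a diagonal
    matrix with real entries; real matrices similar over [R[i]] are similar over [R]. *)
Lemma symmetric_diagonalizable (R : rcfType) n (A : 'M[R]_n) : A^T = A ->
  exists2 P, P \in unitmx & exists d, P *m A = diag_mx d *m P.
Proof.
move=> symA; pose f := map_mx (real_complex R).
have freal m k (M : 'M[R]_(m, k)) : f _ _ M \is a mxOver Num.real.
  by apply/mxOverP => i j; rewrite mxE; apply/complex_realP; exists (M i j).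
have realf m k (M : 'M[R[i]]_(m, k)) : M \is a mxOver Num.real ->
    exists N, M = f _ _ N.
  move=> /mxOverP Mr; exists (map_mx (@complex.Re R) M); apply/matrixP => i j.
  by rewrite !mxE; case/complex_realP: (Mr i j) => x ->.
have herm : f _ _ A \is hermsymmx.
  apply: realsym_hermsym (freal _ _ A).
  by apply/is_hermitianmxP; rewrite expr0 scale1r map_mx_id // map_trmx symA.
have [sp Esp] := realf _ _ _ (hermitian_spectral_diag_real herm).
have /orthomx_spectralP := hermitian_normalmx herm; rewrite Esp => EA.
have sim : similar_in unitmx (f _ _ A) (f _ _ (diag_mx sp)).
  exists (spectralmx (f _ _ A)); first exact: spectral_unit.
  apply/similarP; first exact: spectral_unit.
  move/(congr1 (mulmx (spectralmx (f _ _ A)))): EA => ->.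
  by rewrite /f map_diag_mx -mulmxA mulKVmx ?spectral_unit.
have [_ /andP[/realf[P ->] Pu] Psim] :=
  real_similar sim (freal _ _ _) (freal _ _ _).
exists P; first by move: Pu; rewrite unfold_in /= map_unitmx.
exists sp; move/(similarP Pu): Psim.
rewrite /f -!map_mxM; exact: (@map_mx_inj _ _ (real_complex R)).
Qed.

End Symmetric.

(** * Smoothness of coordinates and of projections *)

Section SmoothMaps.
Variable R : realType.

Lemma mxsub_continuous m n m' n' (f : 'I_m' -> 'I_m) (g : 'I_n' -> 'I_n) :
  continuous (mxsub f g : 'M[R]_(m, n) -> 'M[R]_(m', n')).
Proof.
move=> M s /= /(nbhs_ballP (mxsub f g M)) [e e0 es].
apply/nbhs_ballP; exists e => //= N [_ MN]; apply: es; split=> // i j.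
by rewrite !mxE; exact: MN.
Qed.

Lemma smooth_coord m (U : set 'cV[R]_m) i :
  open U -> smooth_on U (fun x => x i 0).
Proof.
move=> oU [|k]; split=> //; try by move=> x _; exact: coord_continuous.
move=> j; split.
  by move=> x _; apply/diff_derivable; exact: differentiable_coord.
(* A coordinate is linear, hence its own differential, so its partial derivatives are constant. *)
apply: Ck_ext (Ck_cst k ((delta_mx j 0 : 'cV[R]_m) i 0) oU) => // x _.
pose f (M : 'cV[R]_m) : R^o := M i 0.
have lf : linear f by move=> a u v; rewrite /f !mxE.
pose c : {linear 'cV[R]_m -> R^o} :=
  HB.pack f (GRing.isLinear.Build R _ _ _ _ lf).
rewrite deriveE; last exact: differentiable_coord.
by rewrite (@diff_lin _ _ _ c) //; exact: coord_continuous.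
Qed.

Lemma open_prod_cV m m' (U : set 'cV[R]_m) (U' : set 'cV[R]_m') :
  open U -> open U' ->
  open [set x : 'cV[R]_(m + m') | U (usubmx x) /\ U' (dsubmx x)].
Proof.
move=> oU oU'; apply: openI.
  by rewrite usubmxEsub; apply: open_comp oU => x _; exact: mxsub_continuous.
by rewrite dsubmxEsub; apply: open_comp oU' => x _; exact: mxsub_continuous.
Qed.

Lemma smooth_on_ext m (U : set 'cV[R]_m) (f g : 'cV[R]_m -> R) :
  open U -> (forall x, U x -> f x = g x) -> smooth_on U f -> smooth_on U g.
Proof. by move=> oU fg sf k; apply: Ck_ext (sf k). Qed.

(* The types 'cV_(m + 0) and 'cV_m are not convertible. *)
Lemma smooth_on_usubmx0 m (U : set 'cV[R]_m) (f : 'cV[R]_m -> R) :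
  smooth_on [set x : 'cV[R]_(m + 0) | U (usubmx x)] (f \o usubmx) ->
  smooth_on U f.
Proof.
have -> : usubmx = castmx (addn0 m, erefl 1%N) :> ('cV[R]_(m + 0) -> _).
  apply/funext => x; apply/matrixP => i j; rewrite mxE castmxE.
  by congr (x _ _); exact: val_inj.
move: (addn0 m); move: (m + 0)%N => m0 e; case: m / e U f => U f.
by rewrite (_ : castmx _ = id) //; apply/funext => x; rewrite castmx_id.
Qed.

(** Serves the two projections of a product domain: [usubmx] and [dsubmx] are selections of rows. *)
Lemma mxsub_smooth_mapping m m' (s : 'I_m' -> 'I_m) (U : set 'cV[R]_m) U' :
  open U -> (forall x, U x -> U' (rowsub s x)) ->
  smooth_mapping U U' (rowsub s : 'cV[R]_m -> 'cV[R]_m').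
Proof.
move=> oU UU'; split=> // i.
by apply: smooth_on_ext (smooth_coord (s i) oU) => // x _; rewrite mxE.
Qed.

End SmoothMaps.

(** * The image of [A] and its positive eigenvectors *)

Section MatrixForm.
Variables (R : realType) (n : nat).
Implicit Types A : 'M[R]_n.

Lemma gram_matrix_form A : gram_matrix (matrix_form A) = A.
Proof.
apply/matrixP => i j.
by rewrite mxE /matrix_form trmx_delta -rowE -colE !mxE.
Qed.

(** Expand [w] in a basis of eigenvectors: [A] kills those of eigenvalue 0 and rescales the others,
    whose eigenvalues are positive. *)
Lemma mulmx_pos_eigenspan A (w : 'cV[R]_n) : A^T = A ->
  (forall a, eigenvalue A a -> a != 0 -> 0 < a) ->
  A *m w \in pos_eigenspan A.
Proof.
move=> symA posA; have [P Pu [d PA]] := symmetric_diagonalizable symA.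
(* The rows of [P] are left eigenvectors; by symmetry their transposes are right eigenvectors. *)
have AP i : A *m col i P^T = d 0 i *: col i P^T.
  move: (congr1 (row i) PA).
  rewrite !row_mul row_diag_mx -scalemxAl -rowE => /(congr1 trmx).
  by rewrite trmx_mul symA linearZ /= tr_row.
have -> : w = \sum_i (invmx P^T *m w) i 0 *: col i P^T.
  rewrite -{1}[w](mulKVmx (_ : P^T \in unitmx)) ?unitmx_tr //.
  apply/matrixP => j k; rewrite ord1 [LHS]mxE summxE.
  by apply: eq_bigr => i _; rewrite !mxE mulrC.
rewrite mulmx_sumr; apply: memv_suml => i _; rewrite -scalemxAr; apply: memvZ.
rewrite AP; have [->|d0] := eqVneq (d 0 i) 0; first by rewrite scale0r mem0v.
apply/memvZ/spanvP; exists [:: col i P^T]; last by rewrite span_seq1 memv_line.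
have P0 : col i P^T != 0.
  rewrite -tr_row trmx_eq0 rowE mulmx_free_eq0 ?row_free_unit //.
  by apply/eqP => /matrixP/(_ 0 i)/eqP; rewrite !mxE !eqxx oner_eq0.
have eA : eigenvalue A (d 0 i).
  apply/eigenvalueP; exists (row i P); last by rewrite -trmx_eq0 tr_row.
  by rewrite -row_mul PA row_mul row_diag_mx -scalemxAl -rowE.
by move=> x; rewrite inE => /eqP ->; exists (d 0 i); rewrite ?posA //.
Qed.

End MatrixForm.

(** * Plots of [V] from smooth coefficients, and smooth coefficients from plots of the dual *)

Lemma plot_lincomb (R : realType) (E : lmodType R) (V : diffVect E)
    m (U : set 'cV[R]_m) k (c : 'I_k -> 'cV[R]_m -> R) (v : 'I_k -> E) :
  open U -> (forall i, smooth_on U (c i)) ->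
  vplots V U (fun x => \sum_i c i x *: v i).
Proof.
move=> oU cU; have VD := vplots_diffeology V.
elim: (index_enum _) => [|i s IHs].
  by apply: (plot_ext VD) (plot_cst VD 0 oU) => x _; rewrite big_nil.
have civ : vplots V U (fun x => c i x *: v i).
  have := @vscale_smooth _ _ V _ U (fun x => (c i x, v i)); apply.
  by split; [split=> //; exact: cU | exact: plot_cst].
have := @vadd_smooth _ _ V _ U (fun x => (c i x *: v i, _)) (conj civ IHs).
by apply: (plot_ext VD) => x _; rewrite big_cons.
Qed.

(** The vector [w] is a constant plot on the one-point space R^0; testing [q] against it gives
    smoothness on the product of [U] with R^0. *)
Lemma functional_plot_eval (R : realType) (E : vectType R) (V : diffVect E)
    m (U : set 'cV[R]_m) q (w : E) :
  functional_plots V m U q -> smooth_on U (fun x => vsval (q x) w : R).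
Proof.
move=> [oU qU]; apply: smooth_on_usubmx0.
have w0 : vplots V [set: 'cV[R]_0] (fun=> w).
  apply: (plot_cst (vplots_diffeology V)); exact: openT.
have := qU _ _ _ w0; congr (smooth_on _ _).
by apply/seteqP; split=> x //= [].
Qed.

(** Coordinates in the dual of the standard basis, written as a row to be compared with the row
    space of [A]. *)
Definition dual_coords (R : realType) n (f : 'Hom('cV[R]_n, R^o)) : 'rV[R]_n :=
  \row_i f (delta_mx i 0).

Lemma dual_coordsE (R : realType) n (f : 'Hom('cV[R]_n, R^o)) w :
  f w = (dual_coords f *m w) 0 0.
Proof.
rewrite [in LHS](matrix_sum_delta w) linear_sum mxE; apply: eq_bigr => i _.
by rewrite big_ord1 linearZ mxE mulrC.
Qed.

(** * [Psi] is smooth and fills the dual *)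

Section PseudoMetric.
Variables (R : realType) (n : nat) (V : diffVect 'cV[R]_n) (A : 'M[R]_n).
Hypotheses (symA : A^T = A) (pmA : pseudo_metric V (matrix_form A)).

Lemma dual_coords_Psi v : dual_coords (vsval (Psi pmA v)) = v^T *m A.
Proof.
by apply/rowP => i; rewrite mxE PsiE (pm_sym pmA) /matrix_form -colE mxE.
Qed.

(** Diagonalization gives the eigenvalue 0 multiplicity n - rank A, the pseudo-metric n - dim V^*;
    [dimVn] rules out truncation in the latter. *)
Lemma mxrank_dual : \rank A = \dim (dualv V).
Proof.
have dimVn : (\dim (dualv V) <= n)%N.
  apply: leq_trans (dimvS (subvf _)) _.
  by rewrite dimvf /dim /= !muln1 dim_matrix mulr1.
have [P Pu [d PA]] := symmetric_diagonalizable symA.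
have := mup0_char_poly_diagonalizable Pu PA.
have := pm_mult0 pmA; rewrite gram_matrix_form => -> /eqP.
by rewrite -[X in _ == X](subnK dimVn) eqn_add2l => /eqP.
Qed.

(** The row space of [M] is that of all coordinates of smooth functionals. It contains the rows of
    [A], and [M] has only dim V^* = rank A rows, so the two row spaces coincide. *)
Lemma dual_coords_sub f : f \in dualv V -> (dual_coords f <= A)%MS.
Proof.
pose X := vbasis (dualv V).
pose M := \matrix_(j < \dim (dualv V)) dual_coords X`_j.
have lin (u : 'rV_(\dim (dualv V))) :
    u *m M = dual_coords (\sum_j u 0 j *: X`_j).
  rewrite mulmx_sum_row; apply/rowP => i; rewrite summxE mxE sum_lfunE.
  by apply: eq_bigr => j _; rewrite !mxE scale_lfunE.
have subM g : g \in dualv V -> (dual_coords g <= M)%MS.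
  move=> /coord_vbasis ->.
  rewrite (_ : dual_coords _ = (\row_j coord X j g) *m M).
    exact: submxMl.
  by rewrite lin; congr dual_coords; apply: eq_bigr => j _; rewrite mxE.
have freeM : row_free M.
  apply: inj_row_free => u; rewrite lin => u0; apply/rowP => j; rewrite mxE.
  move/freeP: (basis_free (vbasisP (dualv V))) => /(_ (u 0)); apply.
  by apply/lfunP => w; rewrite dual_coordsE u0 mul0mx mxE lfunE.
have AM : (A <= M)%MS.
  (* Row i of [A] holds the coordinates of the image under [Psi] of the i-th standard vector. *)
  apply/row_subP => i; rewrite rowE -trmx_delta -dual_coords_Psi.
  exact: subM (subvsP _).
move=> /subM/submx_trans; apply.
rewrite -(geq_leqif (mxrank_leqif_sup AM)) mxrank_dual.
exact: rank_leq_row.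
Qed.

Lemma Psi_surj f : exists v, Psi pmA v = f.
Proof.
have /submxP[u uf] := dual_coords_sub (subvsP f).
exists u^T; apply/val_inj/lfunP => w.
by rewrite !dual_coordsE dual_coords_Psi trmxK uf.
Qed.

(** Pulled back along the projections, two plots of [V] become one plot of the product on [W], on
    which the form is smooth. *)
Lemma Psi_smooth : smooth V (functional_plots V) (Psi pmA).
Proof.
move=> m U p Vp; have VD := vplots_diffeology V.
have oU := plot_open VD Vp; split=> // m' U' p' Vp'.
have oW := open_prod_cV oU (plot_open VD Vp').
set W := [set _ | _] in oW *.
have Vu : vplots V W (p \o usubmx).
  apply: (plot_comp VD Vp oW); rewrite usubmxEsub.
  by apply: mxsub_smooth_mapping => // x []; rewrite usubmxEsub.
have Vd : vplots V W (p' \o dsubmx).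
  apply: (plot_comp VD Vp' oW); rewrite dsubmxEsub.
  by apply: mxsub_smooth_mapping => // x []; rewrite dsubmxEsub.
have [_] := @pm_smooth _ _ _ _ pmA _ W
  (fun x => (p' (dsubmx x), p (usubmx x))) (conj Vd Vu).
by apply: smooth_on_ext => // x _; rewrite /= (PsiE pmA).
Qed.

End PseudoMetric.

(** * The inverse of [Psi] on [V_0] *)

Theorem theorem2p12 (R : realType) (n : nat) (V : diffVect 'cV[R]_n)
    (A : 'M[R]_n) (symA : A^T = A)
    (pmA : pseudo_metric V (matrix_form A)) :
  diffeomorphism (sub_plots (vplots V) (pos_eigenspan A)) (functional_plots V)
    (fun v : subvs_of (pos_eigenspan A) => Psi pmA (vsval v)).
Proof.
have posA a : eigenvalue A a -> a != 0 -> 0 < a.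
  by have := pm_eigen_gt0 pmA (a := a); rewrite gram_matrix_form.
have /submxP[B AB] := symmetric_sub_sqr symA.
pose g (f : subvs_of (dualv V)) := B *m (dual_coords (vsval f))^T.
have gPsi v : g (Psi pmA v) = B *m (A *m v).
  by rewrite /g dual_coords_Psi trmx_mul symA trmxK.
(* [B] undoes [A] on the image of [A]. *)
have AgP v : B *m (A *m (A *m v)) = A *m v.
  by rewrite !mulmxA -[B *m A *m A]mulmxA -AB.
have AAB : A = A *m A *m B^T by rewrite -[LHS]symA {1}AB !trmx_mul symA.
(* Every [v] differs from a vector in the image of [A] by an element of the kernel of [A], which
   [Psi] does not see. *)
have PsiA v : Psi pmA v = Psi pmA (A *m (B^T *m v)).
  apply/val_inj/lfunP => w; rewrite !PsiE /matrix_form.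
  by rewrite !mulmxA -[_ *m A *m A]mulmxA -[_ *m (A *m A) *m _]mulmxA -AAB.
have gV0 f : g f \in pos_eigenspan A.
  have [v <-] := Psi_surj symA pmA f.
  by rewrite PsiA gPsi AgP mulmx_pos_eigenspan.
have imA v : v \in pos_eigenspan A -> exists u, v = A *m u.
  move=> /spanvP[s sA]; elim: s v sA => [|x s IHs] v sA.
    by rewrite span_nil memv0 => /eqP->; exists 0; rewrite mulmx0.
  rewrite span_cons => /memv_addP[_ /vlineP[k ->] [y ys ->]].
  have [|u ->] := IHs y _ ys.
    by move=> z zs; apply: sA; rewrite in_cons zs orbT.
  have [a a0 [_ Ax]] := sA _ (mem_head x s).
  (* Since A x = a x with a > 0, k x is the image of (k / a) x. *)
  exists ((k / a) *: x + u).
  by rewrite mulmxDr -scalemxAr Ax scalerA divfK ?gt_eqF.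
have Psig f : Psi pmA (g f) = f.
  by have [v <-] := Psi_surj symA pmA f; rewrite (PsiA v) gPsi AgP.
split; first by move=> m U p Vp; exact: (Psi_smooth pmA Vp).
exists (fun f => Subvs (gV0 f)); split=> [v|f|m U q Vq].
- by apply/val_inj; have [u uv] := imA _ (subvsP v); rewrite /= gPsi uv AgP.
- by rewrite /= Psig.
rewrite /sub_plots.
have oU : open U by have [] := Vq.
(* [g] along [q] is a combination of the columns of [B], with the evaluations of [q] at the standard
   vectors as coefficients. *)
have := @plot_lincomb _ _ V _ U n
  (fun i x => vsval (q x) (delta_mx i 0)) (fun i => col i B) oU
  (fun i => functional_plot_eval (delta_mx i 0) Vq).
apply: (plot_ext (vplots_diffeology V)) => x _ /=.
rewrite /g; apply/colP => k; rewrite summxE mxE; apply: eq_bigr => i _.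
by rewrite !mxE mulrC.
Qed.
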